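(* In the calculus $\lambda_1$, for every term $M$ and distributions $D,E$ with $M\mapsto D$ and $M\mapsto E$, there exist distributions $C,C'$ such that $D\to_P C$, $E\to_P C'$ and $C\approx C'$.
   Context: Pre-terms of $\lambda_1$: $M,N::=x\mid MN\mid\lambda x.M\mid\lambda!x.M\mid\,!M\mid M\oplus_pN$ with $p\in(0,1)$ real. Terms are well-formed pre-terms: in every subterm $\lambda x.M$, $x$ has at most one free occurrence in $M$; banged abstractions $\lambda!x.M$ have no restriction. $M[N/x]$ is capture-avoiding substitution. Distributions are finite lists $[(p_i,M_i)]_i$ of pairs of a positive real and a term; $[\,]$ empty list, $::$ cons, $++$ concatenation, $\alpha[(p_i,M_i)]_i=[(\alpha p_i,M_i)]_i$; write $DN=[(p_i,M_iN)]_i$, $ND=[(p_i,NM_i)]_i$, $\lambda x.D=[(p_i,\lambda x.M_i)]_i$, and $\lambda!x.D$, $D\oplus_pN$, $N\oplus_pD$ similarly. The reduction $\mapsto$ is generated by: $(\lambda x.M)N\mapsto[(1,M[N/x])]$; $(\lambda!x.M)\,!N\mapsto[(1,M[N/x])]$; $M\oplus_pN\mapsto[(p,M),(1-p,N)]$; and if $M\mapsto D$ then $M\oplus_pN\mapsto D\oplus_pN$, $N\oplus_pM\mapsto N\oplus_pD$, $MN\mapsto DN$, $NM\mapsto ND$, $\lambda x.M\mapsto\lambda x.D$, $\lambda!x.M\mapsto\lambda!x.D$. Terms $!M$ do not reduce. Parallel evolution $\to_P$ on distributions: $[\,]\to_P[\,]$; if $ds\to_P ds'$ then $(p,a)::ds\to_P(p,a)::ds'$;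 if $a\mapsto F$ and $ds\to_P ds'$ then $(p,a)::ds\to_P pF++ds'$. The relation $\sim$ is the smallest relation on distributions containing $[(p,a),(q,b)]\sim[(q,b),(p,a)]$, $[(p,a),(q,a)]\sim[(p+q,a)]$, $[(p+q,a)]\sim[(p,a),(q,a)]$ and closed under $D\sim D'\Rightarrow E_1++D++E_2\sim E_1++D'++E_2$; $\approx$ is its reflexive-transitive closure.
   Formalization: Terms must also satisfy that in every subterm λx.M the free occurrence of x in M is not inside a subterm !N; without this the claim fails, e.g. for (λx.!x)(a ⊕_p b), which reduces to the normal !(a ⊕_p b) and to [(p,(λx.!x)a),(1-p,(λx.!x)b)]. *)

(* Defs.v *)
From Stdlib Require Export Reals List Relations.
Export ListNotations.
Open Scope R_scope.

(** * Pre-terms, up to alpha-equivalence (de Bruijn indices) *)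

(** The side condition [0 < p < 1] on [Choice p] is part of [wf] below. *)
Inductive preterm : Type :=
| Var (n : nat)
| App (M N : preterm)
| Lam (M : preterm)                       (* λx.M *)
| BLam (M : preterm)                      (* λ!x.M *)
| Bang (M : preterm)                      (* !M *)
| Choice (p : R) (M N : preterm).         (* M ⊕_p N *)

Definition scons {X : Type} (x : X) (s : nat -> X) (n : nat) : X :=
  match n with O => x | S m => s m end.

Fixpoint ren (r : nat -> nat) (M : preterm) : preterm :=
  match M with
  | Var n => Var (r n)
  | App M N => App (ren r M) (ren r N)
  | Lam M => Lam (ren (scons O (fun n => S (r n))) M)
  | BLam M => BLam (ren (scons O (fun n => S (r n))) M)
  | Bang M => Bang (ren r M)
  | Choice p M N => Choice p (ren r M) (ren r N)
  end.

Definition up (s : nat -> preterm) : nat -> preterm :=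
  scons (Var O) (fun n => ren S (s n)).

Fixpoint subst (s : nat -> preterm) (M : preterm) : preterm :=
  match M with
  | Var n => s n
  | App M N => App (subst s M) (subst s N)
  | Lam M => Lam (subst (up s) M)
  | BLam M => BLam (subst (up s) M)
  | Bang M => Bang (subst s M)
  | Choice p M N => Choice p (subst s M) (subst s N)
  end.

(** [M[N/x]], where [x] is index 0 of [M] and the binder of [x] disappears. *)
Definition subst0 (M N : preterm) : preterm := subst (scons N Var) M.

(** * Well-formedness *)

(** Number of free occurrences of index [k]. *)
Fixpoint occ (k : nat) (M : preterm) : nat :=
  match M with
  | Var n => if Nat.eqb n k then 1 else 0
  | App M N => occ k M + occ k N
  | Lam M => occ (S k) M
  | BLam M => occ (S k) M
  | Bang M => occ k M
  | Choice _ M N => occ k M + occ k N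
  end%nat.

(** Number of free occurrences of index [k] lying inside some [!N]. *)
Fixpoint occ_bang (k : nat) (M : preterm) : nat :=
  match M with
  | Var _ => 0
  | App M N => occ_bang k M + occ_bang k N
  | Lam M => occ_bang (S k) M
  | BLam M => occ_bang (S k) M
  | Bang M => occ k M
  | Choice _ M N => occ_bang k M + occ_bang k N
  end%nat.

(** In [λx.M], [x] has at most one free occurrence in [M].  As in Simpson's
    linear lambda-calculus, that occurrence must not lie inside a [!N].  The
    bound on the number of occurrences alone would not suffice: [λx.!x] would
    be a term, and [(λx.!x)(M ⊕_p N)] would reduce both to [!(M ⊕_p N)], which
    is normal, and to [(λx.!x)M] and [(λx.!x)N] with weights [p] and [1-p];
    and [λy.(λ!x.x x) !y] would be a term with the non-term reduct [λy.y y]. *)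
Fixpoint wf (M : preterm) : Prop :=
  match M with
  | Var _ => True
  | App M N => wf M /\ wf N
  | Lam M => (occ 0 M <= 1)%nat /\ occ_bang 0 M = 0%nat /\ wf M
  | BLam M => wf M
  | Bang M => wf M
  | Choice p M N => 0 < p < 1 /\ wf M /\ wf N
  end.

(** * Distributions *)

(** Raw weighted lists; distributions are those satisfying [is_dist]. *)
Definition dist : Type := list (R * preterm).

Definition is_dist (D : dist) : Prop :=
  Forall (fun pa => 0 < fst pa /\ wf (snd pa)) D.

Definition scale (a : R) (D : dist) : dist :=
  map (fun pa => (a * fst pa, snd pa)) D.

(** [dmap f D] renders [D N], [N D], [λx.D], [λ!x.D], [D ⊕_p N], [N ⊕_p D]. *)
Definition dmap (f : preterm -> preterm) (D : dist) : dist :=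
  map (fun pa => (fst pa, f (snd pa))) D.

(** * Reduction *)

Inductive red : preterm -> dist -> Prop :=
| red_beta M N : red (App (Lam M) N) [(1, subst0 M N)]
| red_bbeta M N : red (App (BLam M) (Bang N)) [(1, subst0 M N)]
| red_choice p M N : red (Choice p M N) [(p, M); (1 - p, N)]
| red_choice_l p M N D :
    red M D -> red (Choice p M N) (dmap (fun M' => Choice p M' N) D)
| red_choice_r p M N D :
    red M D -> red (Choice p N M) (dmap (fun M' => Choice p N M') D)
| red_app_l M N D : red M D -> red (App M N) (dmap (fun M' => App M' N) D)
| red_app_r M N D : red M D -> red (App N M) (dmap (fun M' => App N M') D)
| red_lam M D : red M D -> red (Lam M) (dmap Lam D)
| red_blam M D : red M D -> red (BLam M) (dmap BLam D).

(** Parallel evolution [->_P]. *)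
Inductive par : dist -> dist -> Prop :=
| par_nil : par [] []
| par_keep p a ds ds' : par ds ds' -> par ((p, a) :: ds) ((p, a) :: ds')
| par_step p a F ds ds' :
    red a F -> par ds ds' -> par ((p, a) :: ds) (scale p F ++ ds').

(** * Equivalence of distributions *)

(** The positivity premises keep [sim_split] inside distributions. *)
Inductive sim : dist -> dist -> Prop :=
| sim_swap p a q b : sim [(p, a); (q, b)] [(q, b); (p, a)]
| sim_merge p q a : 0 < p -> 0 < q -> sim [(p, a); (q, a)] [(p + q, a)]
| sim_split p q a : 0 < p -> 0 < q -> sim [(p + q, a)] [(p, a); (q, a)]
| sim_ctx E1 D D' E2 : sim D D' -> sim (E1 ++ D ++ E2) (E1 ++ D' ++ E2).

Definition equiv : dist -> dist -> Prop := clos_refl_trans dist sim.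

(* Main.v *)
Require Import Defs.
From Stdlib Require Import Lia Lra Permutation.

(** Two reductions of disjoint subterms commute, up to the order of the products
    of their weights.  A reduction of [M] survives the substitution of [N] in
    [M].  A reduction of [N] survives the substitution of [N] for a variable
    occurring exactly once and outside every [!]; if the variable does not
    occur, or if the reduced term is dropped by a probabilistic choice, all the
    reducts become equal, and their weights, which sum to [1], can be merged. *)

(** * Substitution *)

(** Agreement is asked only on indices that occur in [M]. This makes replacing a variable that does
    not occur in [M] invisible, as erasing and linear substitution both require. *)
Lemma subst_ext M : forall s t,
  (forall n, occ n M <> 0%nat -> s n = t n) -> subst s M = subst t M.
Proof.
  assert (Hup : forall s t M', (forall n, occ (S n) M' <> 0%nat -> s n = t n) ->
    forall n, occ n M' <> 0%nat -> up s n = up t n).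
  { intros s t M' H [|n] Hn; simpl; [reflexivity | now rewrite (H n Hn)]. }
  induction M; intros s t H; simpl in *.
  - apply H. now rewrite Nat.eqb_refl.
  - f_equal; [apply IHM1 | apply IHM2]; intros n Hn; apply H; lia.
  - f_equal. apply IHM, Hup, H.
  - f_equal. apply IHM, Hup, H.
  - f_equal. now apply IHM.
  - f_equal; [apply IHM1 | apply IHM2]; intros n Hn; apply H; lia.
Qed.

Lemma ren_as_subst M : forall r, ren r M = subst (fun n => Var (r n)) M.
Proof.
  induction M; intros r; simpl; f_equal; auto;
    rewrite IHM; apply subst_ext; now intros [|n].
Qed.

Lemma subst_ren M : forall s r, subst s (ren r M) = subst (fun n => s (r n)) M.
Proof.
  induction M; intros s r; simpl; f_equal; auto;
    rewrite IHM; apply subst_ext; now intros [|n].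
Qed.

Lemma ren_ren M a b : ren a (ren b M) = ren (fun n => a (b n)) M.
Proof. now rewrite ren_as_subst, subst_ren, ren_as_subst. Qed.

Lemma ren_subst M : forall s r, ren r (subst s M) = subst (fun n => ren r (s n)) M.
Proof.
  induction M; intros s r; simpl; f_equal; auto;
    rewrite IHM; apply subst_ext; intros [|n] _; simpl; auto;
    now rewrite !ren_ren.
Qed.

Lemma subst_subst M : forall s t,
  subst t (subst s M) = subst (fun n => subst t (s n)) M.
Proof.
  induction M; intros s t; simpl; f_equal; auto;
    rewrite IHM; apply subst_ext; intros [|n] _; simpl; auto;
    now rewrite subst_ren, ren_subst.
Qed.

Lemma subst_id M : subst Var M = M.
Proof.
  induction M; simpl; f_equal; auto;
    rewrite <- IHM at 2; apply subst_ext; now intros [|n].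
Qed.

Lemma subst_subst0 s M N :
  subst s (subst0 M N) = subst0 (subst (up s) M) (subst s N).
Proof.
  unfold subst0. rewrite !subst_subst. apply subst_ext. intros [|n] _; simpl; auto.
  rewrite subst_ren. symmetry. apply subst_id.
Qed.

(** * Occurrences and well-formedness *)

(** The case [c = 0] is that of an index [k'] outside the range of [r]. *)
Lemma occ_ren c M : forall r k k',
  (forall n, occ k' (Var (r n)) = c * occ k (Var n))%nat ->
  (occ k' (ren r M) = c * occ k M /\ occ_bang k' (ren r M) = c * occ_bang k M)%nat.
Proof.
  assert (Hup : forall r k k',
    (forall n, occ k' (Var (r n)) = c * occ k (Var n))%nat ->
    (forall n, occ (S k') (Var (scons 0 (fun n => S (r n)) n)) = c * occ (S k) (Var n))%nat).
  { intros r k k' H [|n]; [simpl; lia | apply H]. }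
  induction M; intros r k k' H; simpl occ_bang; simpl ren.
  - split; [apply H | lia].
  - destruct (IHM1 _ _ _ H), (IHM2 _ _ _ H). simpl. lia.
  - apply (IHM _ _ _ (Hup _ _ _ H)).
  - apply (IHM _ _ _ (Hup _ _ _ H)).
  - destruct (IHM _ _ _ H). simpl. lia.
  - destruct (IHM1 _ _ _ H), (IHM2 _ _ _ H). simpl. lia.
Qed.

Lemma occ_ren_S k M :
  (occ (S k) (ren S M) = occ k M /\ occ_bang (S k) (ren S M) = occ_bang k M)%nat.
Proof.
  destruct (occ_ren 1 M S k (S k)); [intros n; simpl; lia | lia].
Qed.

Lemma occ_ren_0 M : (occ 0 (ren S M) = 0 /\ occ_bang 0 (ren S M) = 0)%nat.
Proof. destruct (occ_ren 0 M S 0 0); [intros n; simpl; lia | lia]. Qed.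

(** The situation is that of [s] replacing [j] by a term with [c] occurrences of
    [k], none of them in a [!N], and renaming [k'] to [k]. *)
Lemma occ_subst c M : forall s k k' j,
  (forall n, occ k (s n) = occ k' (Var n) + c * occ j (Var n))%nat ->
  (forall n, occ_bang k (s n) = 0%nat) ->
  (occ k (subst s M) = occ k' M + c * occ j M /\
   occ_bang k (subst s M) = occ_bang k' M + c * occ_bang j M)%nat.
Proof.
  assert (Hup : forall s k k' j,
    (forall n, occ k (s n) = occ k' (Var n) + c * occ j (Var n))%nat ->
    (forall n, occ (S k) (up s n) = occ (S k') (Var n) + c * occ (S j) (Var n))%nat).
  { intros s k k' j H [|n]; [simpl; lia |].
    simpl up. rewrite (proj1 (occ_ren_S _ _)). apply H. }
  assert (Hupb : forall s k, (forall n, occ_bang k (s n) = 0%nat) ->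
    forall n, occ_bang (S k) (up s n) = 0%nat).
  { intros s k H [|n]; [reflexivity |].
    simpl up. now rewrite (proj2 (occ_ren_S _ _)). }
  induction M; intros s k k' j H Hb; simpl occ_bang; simpl subst.
  - rewrite H, Hb. lia.
  - destruct (IHM1 _ _ _ _ H Hb), (IHM2 _ _ _ _ H Hb). simpl. lia.
  - apply (IHM _ _ _ _ (Hup _ _ _ _ H) (Hupb _ _ Hb)).
  - apply (IHM _ _ _ _ (Hup _ _ _ _ H) (Hupb _ _ Hb)).
  - destruct (IHM _ _ _ _ H Hb). simpl. lia.
  - destruct (IHM1 _ _ _ _ H Hb), (IHM2 _ _ _ _ H Hb). simpl. lia.
Qed.

(** This is the case [c = 0] of [occ_subst]: [up s] fixes index 0 and shifts every other image away
    from it. Hence the linearity condition of a binder survives substitution. *)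
Lemma occ_subst_up s M :
  (occ 0 (subst (up s) M) = occ 0 M /\ occ_bang 0 (subst (up s) M) = occ_bang 0 M)%nat.
Proof.
  destruct (occ_subst 0 M (up s) 0 0 0) as [H H'].
  - intros [|n]; simpl; [lia | now rewrite (proj1 (occ_ren_0 _))].
  - intros [|n]; simpl; [lia | apply occ_ren_0].
  - lia.
Qed.

Lemma occ_subst0 k M N : occ_bang k N = 0%nat ->
  (occ k (subst0 M N) = occ (S k) M + occ k N * occ 0 M /\
   occ_bang k (subst0 M N) = occ_bang (S k) M + occ k N * occ_bang 0 M)%nat.
Proof.
  intros HN. apply occ_subst.
  - intros [|n]; simpl; lia.
  - now intros [|n].
Qed.

(** * Preservation of well-formedness *)

Lemma wf_ren M : forall r, wf M -> wf (ren r M).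
Proof.
  induction M; intros r H; simpl in *; intuition auto.
  all: destruct (occ_ren 1 M (scons 0%nat (fun n => S (r n))) 0 0) as [Ho Hb];
    [intros [|n]; simpl; lia | lia].
Qed.

Lemma wf_subst M : forall s, wf M -> (forall n, wf (s n)) -> wf (subst s M).
Proof.
  assert (Hup : forall s, (forall n, wf (s n)) -> forall n, wf (up s n)).
  { intros s H [|n]; simpl; auto using wf_ren. }
  induction M; intros s H Hs; simpl in *; intuition auto.
  - now rewrite (proj1 (occ_subst_up _ _)).
  - now rewrite (proj2 (occ_subst_up _ _)).
Qed.

Lemma wf_subst0 M N : wf M -> wf N -> wf (subst0 M N).
Proof. intros HM HN. apply wf_subst; auto. now intros [|n]. Qed.

Lemma occ_bang_le k M : (occ_bang k M <= occ k M)%nat.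
Proof.
  revert k. induction M; intros k; simpl; auto; try lia.
  - specialize (IHM1 k); specialize (IHM2 k); lia.
  - specialize (IHM1 k); specialize (IHM2 k); lia.
Qed.

(** Only substitution could duplicate [k], and linearity or the absence of [k] from banged arguments
    excludes this. At [k = 0] it shows that reducing under [Lam] keeps the binder linear. *)
Lemma red_occ M D : red M D -> forall k, wf M -> occ_bang k M = 0%nat ->
  Forall (fun pa => (occ k (snd pa) <= occ k M)%nat /\ occ_bang k (snd pa) = 0%nat) D.
Proof.
  induction 1; intros k Hwf Hk; simpl in *;
    try (apply Forall_map; apply Forall_impl with (2 := IHred k ltac:(tauto) ltac:(lia));
         simpl; now intuition lia).
  - constructor; [simpl | constructor].
    (* Linearity makes the factor [occ 0 M] at most 1 and [occ_bang 0 M] zero. *)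
    destruct Hwf as [(H1 & H2 & _) _].
    destruct (occ_subst0 k M N) as [-> ->]; [lia |]. split; nia.
  - constructor; [simpl | constructor].
    (* Here [Hk] forces [occ k N = 0], since [N] stands under a bang; copying [N] then creates no
       occurrence of [k]. *)
    pose proof (occ_bang_le k N).
    destruct (occ_subst0 k M N) as [-> ->]; [lia |]. split; nia.
  - repeat constructor; simpl; lia.
  - apply Forall_map, (IHred (S k)); [tauto | lia].
  - apply Forall_map, (IHred (S k)); [tauto | lia].
Qed.

Lemma red_is_dist M D : red M D -> wf M -> is_dist D.
Proof.
  unfold is_dist.
  induction 1; intros Hwf; simpl in Hwf;
    try (apply Forall_map; eapply Forall_impl; [| apply IHred; tauto]; simpl;
         now intuition auto).
  - repeat constructor; simpl; [lra | apply wf_subst0; tauto].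
  - repeat constructor; simpl; [lra | apply wf_subst0; tauto].
  - repeat constructor; simpl; tauto || lra.
  - destruct Hwf as (H1 & H2 & H3).
    apply Forall_map. pose proof (red_occ _ _ H 0 H3 H2) as Hocc.
    specialize (IHred H3).
    rewrite Forall_forall in *. intros pa Hpa.
    destruct (IHred pa Hpa), (Hocc pa Hpa). simpl. repeat split; auto; lia.
Qed.

Lemma par_is_dist D C : par D C -> is_dist D -> is_dist C.
Proof.
  unfold is_dist. induction 1 as [| p a ds ds' _ IH | p a F ds ds' HF _ IH]; intros HD.
  - exact HD.
  - inversion HD; subst. now constructor; auto.
  - inversion HD as [| x l [Hp Ha] Hds]; subst. simpl in Hp, Ha.
    apply Forall_app. split; [| auto].
    apply Forall_map. eapply Forall_impl; [| exact (red_is_dist _ _ HF Ha)].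
    intros [q b] [Hq Hb]. simpl in *. split; auto using Rmult_lt_0_compat.
Qed.

(** * Weighted lists *)

Definition weight (D : dist) : R := fold_right (fun pa w => fst pa + w) 0 D.

Lemma weight_dmap f D : weight (dmap f D) = weight D.
Proof. induction D; simpl; congruence. Qed.

Lemma red_weight M D : red M D -> weight D = 1.
Proof. induction 1; rewrite ?weight_dmap; simpl; auto; lra. Qed.

Lemma dmap_dmap f g D : dmap f (dmap g D) = dmap (fun a => f (g a)) D.
Proof. unfold dmap. now rewrite map_map. Qed.

Lemma dmap_ext f g D : (forall a, f a = g a) -> dmap f D = dmap g D.
Proof. intros H. apply map_ext. intros pa. now rewrite H. Qed.

Lemma dmap_scale f p D : dmap f (scale p D) = scale p (dmap f D).
Proof. unfold dmap, scale. now rewrite !map_map. Qed.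

(** * Congruence properties of the equivalence, and merging of equal terms *)

Lemma equiv_refl D : equiv D D.
Proof. apply rt_refl. Qed.

Lemma equiv_trans D E F : equiv D E -> equiv E F -> equiv D F.
Proof. apply rt_trans. Qed.

Lemma equiv_sym D E : equiv D E -> equiv E D.
Proof.
  assert (Hsim : forall D E, sim D E -> sim E D) by (induction 1; now constructor).
  induction 1.
  - apply rt_step; auto.
  - apply rt_refl.
  - eapply rt_trans; eassumption.
Qed.

Lemma equiv_ctx E1 E2 D D' : equiv D D' -> equiv (E1 ++ D ++ E2) (E1 ++ D' ++ E2).
Proof.
  induction 1.
  - apply rt_step. now constructor.
  - apply rt_refl.
  - eapply rt_trans; eassumption.
Qed.

Lemma equiv_app_l E D D' : equiv D D' -> equiv (E ++ D) (E ++ D').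
Proof. intros H. generalize (equiv_ctx E [] D D' H). now rewrite !app_nil_r. Qed.

Lemma equiv_dmap f D E : equiv D E -> equiv (dmap f D) (dmap f E).
Proof.
  induction 1 as [D E H | | ].
  - apply rt_step. induction H; simpl; try now constructor.
    unfold dmap in *. rewrite !map_app. now constructor.
  - apply rt_refl.
  - eapply rt_trans; eassumption.
Qed.

Lemma Permutation_equiv D E : Permutation D E -> equiv D E.
Proof.
  induction 1 as [| x l l' _ IH | [p a] [q b] l | ].
  - apply equiv_refl.
  - now apply (equiv_app_l [x]).
  - apply (equiv_ctx [] l [(q, b); (p, a)] [(p, a); (q, b)]).
    apply rt_step, sim_swap.
  - eapply equiv_trans; eassumption.
Qed.

Definition positive (D : dist) : Prop := Forall (fun pa => 0 < fst pa) D.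

Lemma is_dist_positive D : is_dist D -> positive D.
Proof. apply Forall_impl. now intros pa [H _]. Qed.

Lemma weight_positive_cons x D : positive (x :: D) -> 0 < weight (x :: D).
Proof.
  intros H. inversion H as [| y l Hx HD]; subst. simpl.
  enough (0 <= weight D) by lra.
  clear H Hx. induction HD; simpl; lra.
Qed.

(** The entries are merged one by one from the right. Positive weight excludes the empty list, and
    positivity of the entries provides the premises of [sim_merge]. *)
Lemma equiv_merge a D : positive D -> 0 < weight D ->
  equiv (dmap (fun _ => a) D) [(weight D, a)].
Proof.
  intros HD. induction HD as [| [p b] D Hp HD IH]; intros Hw; simpl in *; [lra |].
  destruct D as [| x D].
  - simpl. rewrite Rplus_0_r. apply equiv_refl.
  - pose proof (weight_positive_cons x D HD) as Hpos.
    eapply equiv_trans.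
    + apply (equiv_app_l [(p, a)]), IH, Hpos.
    + apply rt_step. now apply sim_merge.
Qed.

(** * Rearrangement of double enumerations *)

Lemma Permutation_flat_map_app {A B} (u v : A -> list B) l :
  Permutation (flat_map (fun x => u x ++ v x) l) (flat_map u l ++ flat_map v l).
Proof.
  induction l as [| x l IH]; simpl; [constructor |].
  rewrite IH, <- !app_assoc. apply Permutation_app_head.
  rewrite !app_assoc. apply Permutation_app_tail, Permutation_app_comm.
Qed.

Lemma flat_map_singleton {A B} (h : A -> B) l :
  flat_map (fun x => [h x]) l = map h l.
Proof. induction l; simpl; congruence. Qed.

Lemma Permutation_flat_map_swap {A B C} (g : A -> B -> C) l m :
  Permutation (flat_map (fun x => map (g x) m) l)
              (flat_map (fun y => map (fun x => g x y) l) m).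
Proof.
  induction l as [| x l IH]; simpl.
  - induction m; simpl; auto.
  (* A new row [x] puts one entry in front of each column, so it is split off as a family of
     singleton lists. *)
  - rewrite IH, <- flat_map_singleton. symmetry.
    apply (Permutation_flat_map_app (fun y => [g x y])).
Qed.

(** * Reduction under substitution *)

Lemma red_subst M D : red M D -> forall s, red (subst s M) (dmap (subst s) D).
Proof.
  induction 1; intros s; simpl; rewrite ?subst_subst0, ?dmap_dmap;
    try (now constructor); rewrite <- dmap_dmap.
  - specialize (IHred s). apply (red_choice_l p _ (subst s N)) in IHred.
    now rewrite !dmap_dmap in *.
  - specialize (IHred s). apply (red_choice_r p _ (subst s N)) in IHred.
    now rewrite !dmap_dmap in *.
  - specialize (IHred s). apply (red_app_l _ (subst s N)) in IHred.
    now rewrite !dmap_dmap in *.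
  - specialize (IHred s). apply (red_app_r _ (subst s N)) in IHred.
    now rewrite !dmap_dmap in *.
  - specialize (IHred (up s)). apply red_lam in IHred.
    now rewrite !dmap_dmap in *.
  - specialize (IHred (up s)). apply red_blam in IHred.
    now rewrite !dmap_dmap in *.
Qed.

Lemma red_ren M D r : red M D -> red (ren r M) (dmap (ren r) D).
Proof.
  intros H. rewrite ren_as_subst, (dmap_ext (ren r) _ _ (fun a => ren_as_subst a r)).
  now apply red_subst.
Qed.

(** [t a] stands for [s] with its value at [j] replaced by a reduct [a]; a
    family is used because [up] renames the reducts. *)
Lemma red_subst_linear M D : forall (t : preterm -> nat -> preterm) s j,
  occ j M = 1%nat -> occ_bang j M = 0%nat ->
  red (s j) (dmap (fun a => t a j) D) ->
  (forall a n, n <> j -> t a n = s n) ->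
  red (subst s M) (dmap (fun a => subst (t a) M) D).
Proof.
  assert (Hconst : forall t s j M', (forall a n, n <> j -> t a n = s n) ->
    occ j M' = 0%nat -> forall a : preterm, subst (t a) M' = subst s M').
  { intros t s j M' H HM a. apply subst_ext. intros n Hn. apply H. congruence. }
  assert (Hup : forall (t : preterm -> nat -> preterm) s j,
    red (s j) (dmap (fun a => t a j) D) ->
    red (up s (S j)) (dmap (fun a => up (t a) (S j)) D)).
  { intros t s j H. apply (red_ren _ _ S) in H. now rewrite dmap_dmap in H. }
  assert (Hups : forall (t : preterm -> nat -> preterm) s j,
    (forall a n, n <> j -> t a n = s n) ->
    forall a n, n <> S j -> up (t a) n = up s n).
  { intros t s j H a [|n] Hn; simpl; [reflexivity | rewrite H; auto]. }
  induction M; intros t s j H1 Hb Hred Hs; simpl in H1, Hb |- *.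
  - destruct (Nat.eqb_spec n j); [now subst | discriminate].
  (* The single occurrence of [j] lies in exactly one component; by [Hconst] the other does not
     depend on the reduct [a], so one congruence step suffices. *)
  - destruct (occ j M1) as [| m] eqn:Ho.
    + rewrite (dmap_ext _ (fun a => App (subst s M1) (subst (t a) M2)))
        by (intros a; now rewrite (Hconst t s j M1)).
      rewrite <- (dmap_dmap (App (subst s M1))).
      apply red_app_r. apply (IHM2 _ _ j); auto; lia.
    + rewrite (dmap_ext _ (fun a => App (subst (t a) M1) (subst s M2)))
        by (intros a; rewrite (Hconst t s j M2); auto; lia).
      rewrite <- (dmap_dmap (fun a => App a (subst s M2)) (fun a => subst (t a) M1)).
      apply red_app_l. apply (IHM1 _ _ j); auto; lia.
  - rewrite <- (dmap_dmap Lam).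
    apply red_lam. apply (IHM (fun a => up (t a)) _ (S j)); eauto.
  - rewrite <- (dmap_dmap BLam).
    apply red_blam. apply (IHM (fun a => up (t a)) _ (S j)); eauto.
  (* Under a bang, [H1] and [Hb] give [occ j M] the values 1 and 0. *)
  - lia.
  - destruct (occ j M1) as [| m] eqn:Ho.
    + rewrite (dmap_ext _ (fun a => Choice p (subst s M1) (subst (t a) M2)))
        by (intros a; now rewrite (Hconst t s j M1)).
      rewrite <- (dmap_dmap (Choice p (subst s M1))).
      apply red_choice_r. apply (IHM2 _ _ j); auto; lia.
    + rewrite (dmap_ext _ (fun a => Choice p (subst (t a) M1) (subst s M2)))
        by (intros a; rewrite (Hconst t s j M2); auto; lia).
      rewrite <- (dmap_dmap (fun a => Choice p a (subst s M2)) (fun a => subst (t a) M1)).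
      apply red_choice_l. apply (IHM1 _ _ j); auto; lia.
Qed.

Lemma red_subst0_linear M N D : occ 0 M = 1%nat -> occ_bang 0 M = 0%nat ->
  red N D -> red (subst0 M N) (dmap (subst0 M) D).
Proof.
  intros H1 Hb H. apply (red_subst_linear M D (fun a => scons a Var) _ 0 H1 Hb).
  - unfold dmap. now rewrite (map_ext _ (fun pa => pa)), map_id by now intros [].
  - intros a [|n]; [congruence | reflexivity].
Qed.

Lemma subst0_const M N N' : occ 0 M = 0%nat -> subst0 M N = subst0 M N'.
Proof. intros H. apply subst_ext. now intros [|n]. Qed.

(** * Joining one-step reducts *)

(** This speaks of raw weighted lists; [par_is_dist] makes the closing lists distributions when [D]
    and [E] are. *)
Definition joinable (D E : dist) : Prop :=
  exists C C', par D C /\ par E C' /\ equiv C C'.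

Lemma joinable_sym D E : joinable D E -> joinable E D.
Proof. intros (C & C' & H1 & H2 & H3). exists C', C. auto using equiv_sym. Qed.

Lemma par_refl D : par D D.
Proof. induction D as [| [p a] D IH]; now constructor. Qed.

Lemma joinable_refl D : joinable D D.
Proof. exists D, D. auto using par_refl, equiv_refl. Qed.

Lemma par_single p a F : red a F -> par [(p, a)] (scale p F).
Proof. intros H. rewrite <- (app_nil_r (scale p F)). now repeat constructor. Qed.

Lemma par_dmap_red g F D : (forall a, red (g a) (F a)) ->
  par (dmap g D) (flat_map (fun pa => scale (fst pa) (F (snd pa))) D).
Proof. intros H. induction D; simpl; now constructor. Qed.

Lemma par_dmap f D C :
  (forall M F, red M F -> red (f M) (dmap f F)) ->
  par D C -> par (dmap f D) (dmap f C).
Proof.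
  intros Hf. induction 1; simpl.
  - constructor.
  - now constructor.
  - unfold dmap at 2. rewrite map_app.
    fold (dmap f (scale p F)) (dmap f ds'). rewrite dmap_scale.
    constructor; auto.
Qed.

Lemma joinable_dmap f D E :
  (forall M F, red M F -> red (f M) (dmap f F)) ->
  joinable D E -> joinable (dmap f D) (dmap f E).
Proof.
  intros Hf (C & C' & H1 & H2 & H3).
  exists (dmap f C), (dmap f C'). auto using par_dmap, equiv_dmap.
Qed.

Lemma joinable_independent (f : preterm -> preterm -> preterm) M N D E :
  (forall M N D, red M D -> red (f M N) (dmap (fun M' => f M' N) D)) ->
  (forall M N E, red N E -> red (f M N) (dmap (f M) E)) ->
  red M D -> red N E ->
  joinable (dmap (fun M' => f M' N) D) (dmap (f M) E).
Proof.
  intros Hl Hr HM HN.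
  exists (flat_map (fun pa => scale (fst pa) (dmap (f (snd pa)) E)) D).
  exists (flat_map (fun qb => scale (fst qb) (dmap (fun M' => f M' (snd qb)) D)) E).
  split; [| split].
  - apply (par_dmap_red _ (fun a => dmap (f a) E)). auto.
  - apply (par_dmap_red _ (fun b => dmap (fun a => f a b) D)). auto.
  - apply Permutation_equiv.
    (* [g] is the matrix of joint outcomes: one side lists it by rows, the other by columns with the
       factors of each weight exchanged. *)
    pose (g := fun pa qb : R * preterm => (fst pa * fst qb, f (snd pa) (snd qb))).
    rewrite (flat_map_ext _ (fun pa => map (g pa) E)), Permutation_flat_map_swap.
    + rewrite (flat_map_ext _ (fun qb => scale (fst qb) (dmap (fun M' => f M' (snd qb)) D))).
      * reflexivity.
      * intros qb. unfold scale, dmap. rewrite map_map.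
        apply map_ext. intros pa. unfold g. simpl. now rewrite Rmult_comm.
    + intros pa. unfold scale, dmap. now rewrite map_map.
Qed.

(** Both sides reach the very list [dmap h D]: on the left every [g a] fires, on the right [b] does.
    This closes a contraction against a step in the function body or in a linear argument. *)
Lemma joinable_deterministic g h b D :
  (forall a, red (g a) [(1, h a)]) -> red b (dmap h D) ->
  joinable (dmap g D) [(1, b)].
Proof.
  intros Hg Hb. exists (dmap h D), (dmap h D). split; [| split; [| apply equiv_refl]].
  - replace (dmap h D) with (flat_map (fun pa => scale (fst pa) [(1, h (snd pa))]) D).
    + now apply (par_dmap_red g (fun a => [(1, h a)])).
    + unfold scale; simpl. rewrite flat_map_singleton. apply map_ext.
      intros pa. now rewrite Rmult_1_r.
  - replace (dmap h D) with (scale 1 (dmap h D)) at 1.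
    + now apply par_single.
    + unfold scale, dmap. rewrite map_map. apply map_ext.
      intros pa. simpl. now rewrite Rmult_1_l.
Qed.

(** All entries on the left collapse to [b] and their weights are merged into 1, while the right
    side stays put. *)
Lemma joinable_erasing g b D :
  (forall a, red (g a) [(1, b)]) -> positive D -> weight D = 1 ->
  joinable (dmap g D) [(1, b)].
Proof.
  intros Hg HD Hw. exists (dmap (fun _ => b) D), [(1, b)].
  split; [| split; [apply par_refl |]].
  - replace (dmap (fun _ => b) D) with (flat_map (fun pa => scale (fst pa) [(1, b)]) D).
    + now apply (par_dmap_red g (fun _ => [(1, b)])).
    + unfold scale; simpl. rewrite flat_map_singleton. apply map_ext.
      intros pa. now rewrite Rmult_1_r.
  - rewrite <- Hw. apply equiv_merge; auto. lra.
Qed.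

Lemma joinable_beta_arg M N D :
  (occ 0 M <= 1)%nat -> occ_bang 0 M = 0%nat ->
  red N D -> positive D ->
  joinable (dmap (App (Lam M)) D) [(1, subst0 M N)].
Proof.
  (* An argument that is erased and one that is used once are joined in different ways. *)
  intros H1 Hb H HD. destruct (occ 0 M) as [| k] eqn:Ho.
  - apply joinable_erasing; [| assumption | eapply red_weight; eassumption].
    intros a. rewrite (subst0_const M N a Ho). constructor.
  - apply (joinable_deterministic _ (subst0 M)); [constructor |].
    apply red_subst0_linear; auto; lia.
Qed.

(** If one component of a choice is reduced first, the other component [b]
    occurs once for each reduct, with total weight [q]. *)
Lemma equiv_choice p q b D : positive D -> weight D = 1 -> 0 < q ->
  equiv (flat_map (fun pa => scale (fst pa) [(p, snd pa); (q, b)]) D)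
        (scale p D ++ [(q, b)]).
Proof.
  intros HD Hw Hq. eapply equiv_trans.
  - apply Permutation_equiv.
    apply (Permutation_flat_map_app (fun pa => [(fst pa * p, snd pa)])
                                    (fun pa => [(fst pa * q, b)])).
  - rewrite !flat_map_singleton.
    rewrite (map_ext _ (fun pa => (p * fst pa, snd pa)))
      by (intros pa; now rewrite Rmult_comm).
    apply equiv_app_l.
    replace (map (fun pa => (fst pa * q, b)) D) with (dmap (fun _ => b) (scale q D)).
    + assert (Hwq : weight (scale q D) = q).
      { transitivity (q * weight D); [| rewrite Hw; lra].
        clear. induction D; simpl; [lra |]. rewrite IHD. lra. }
      (* The weight [q] of the target entry is rewritten as a total weight, the form in which
         [equiv_merge] concludes. *)
      rewrite <- Hwq at 2. apply equiv_merge; [| lra].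
      apply Forall_map. eapply Forall_impl; [| exact HD].
      intros pa Hpa. simpl. auto using Rmult_lt_0_compat.
    + unfold dmap, scale. rewrite map_map. apply map_ext.
      intros pa. simpl. now rewrite Rmult_comm.
Qed.

(** On the left every choice is resolved; on the right only [M] is reduced and [N] is kept. The
    copies of [N] on the left are then merged. *)
Lemma joinable_choice_l p M N D : p < 1 -> red M D -> positive D ->
  joinable (dmap (fun M' => Choice p M' N) D) [(p, M); (1 - p, N)].
Proof.
  intros Hp H HD.
  exists (flat_map (fun pa => scale (fst pa) [(p, snd pa); (1 - p, N)]) D).
  exists (scale p D ++ [(1 - p, N)]). split; [| split].
  - apply (par_dmap_red _ (fun a => [(p, a); (1 - p, N)])). constructor.
  - constructor; [assumption | apply par_refl].
  - apply equiv_choice; eauto using red_weight; lra.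
Qed.

Lemma joinable_choice_r p M N D : 0 < p -> red N D -> positive D ->
  joinable (dmap (fun N' => Choice p M N') D) [(p, M); (1 - p, N)].
Proof.
  intros Hp H HD.
  exists (flat_map (fun pa => scale (fst pa) [(p, M); (1 - p, snd pa)]) D).
  exists ((p, M) :: scale (1 - p) D). split; [| split].
  - apply (par_dmap_red _ (fun a => [(p, M); (1 - p, a)])). constructor.
  - apply par_keep, par_single, H.
  - eapply equiv_trans; [| eapply equiv_trans].
    (* The roles of [p] and [1 - p] are exchanged, so each pair is swapped beforehand and the merged
       entry for [M] is moved to the front afterwards. *)
    2: apply (equiv_choice (1 - p) p M D); eauto using red_weight.
    + apply Permutation_equiv. clear. induction D; simpl; [constructor |].
      rewrite IHD. apply perm_swap.
    + apply Permutation_equiv. symmetry. apply Permutation_cons_append.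
Qed.

(** An abstraction reduces only in its body, and [red_subst] holds for every substitution, so the
    number of occurrences of the bound variable does not matter. *)
Lemma joinable_beta_fun M N D : red (Lam M) D ->
  joinable (dmap (fun L => App L N) D) [(1, subst0 M N)].
Proof.
  intros H. inversion H as [| | | | | | | M' D0 H0 |]; subst. rewrite dmap_dmap.
  apply (joinable_deterministic _ (fun a => subst0 a N)); [constructor |].
  now apply red_subst.
Qed.

Lemma joinable_bbeta_fun M N D : red (BLam M) D ->
  joinable (dmap (fun L => App L (Bang N)) D) [(1, subst0 M N)].
Proof.
  intros H. inversion H as [| | | | | | | | M' D0 H0]; subst. rewrite dmap_dmap.
  apply (joinable_deterministic _ (fun a => subst0 a N)); [constructor |].
  now apply red_subst.
Qed.

Lemma red_positive M D : wf M -> red M D -> positive D.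
Proof. eauto using is_dist_positive, red_is_dist. Qed.

Lemma red_joinable M D E : wf M -> red M D -> red M E -> joinable D E.
Proof.
  intros Hwf HD. revert Hwf E.
  induction HD as [M N | M N | p M N | p M N D H IH | p M N D H IH
                  | M N D H IH | M N D H IH | M D H IH | M D H IH];
    intros Hwf E HE; inversion HE; subst; simpl in Hwf;
    (* These two lines settle the pairs contracting the same root redex and those reducing the same
       immediate subterm. What remains is a root contraction against an inner step, or steps in two
       disjoint subterms. *)
    try apply joinable_refl;
    try (apply joinable_dmap; [constructor; assumption | apply IH; tauto]).
  - apply joinable_sym. now apply joinable_beta_fun.
  - apply joinable_sym. apply joinable_beta_arg; try tauto.
    eapply red_positive; [| eassumption]; tauto.
  - apply joinable_sym. now apply joinable_bbeta_fun.
  (* A banged argument is normal, so it cannot compete with the contraction that copies it. *)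
  - match goal with H : red (Bang _) _ |- _ => inversion H end.
  - apply joinable_sym. apply joinable_choice_l; try tauto.
    eapply red_positive; [| eassumption]; tauto.
  - apply joinable_sym. apply joinable_choice_r; try tauto.
    eapply red_positive; [| eassumption]; tauto.
  - apply joinable_choice_l; try tauto.
    eapply red_positive; [| eassumption]; tauto.
  - apply joinable_independent; try (constructor; assumption); assumption.
  - apply joinable_choice_r; try tauto.
    eapply red_positive; [| eassumption]; tauto.
  - apply joinable_sym.
    apply joinable_independent; try (constructor; assumption); assumption.
  - now apply joinable_beta_fun.
  - now apply joinable_bbeta_fun.
  - apply joinable_independent; try (constructor; assumption); assumption.
  - apply joinable_beta_arg; try tauto.
    eapply red_positive; [| eassumption]; tauto.
  - inversion H.
  - apply joinable_sym.
    apply joinable_independent; try (constructor; assumption); assumption.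
Qed.

Theorem theorem6p3 :
  forall (M : preterm) (D E : dist),
    wf M -> is_dist D -> is_dist E ->
    red M D -> red M E ->
    exists C C' : dist,
      is_dist C /\ is_dist C' /\ par D C /\ par E C' /\ equiv C C'.
Proof.
  intros M D E Hwf HD HE HMD HME.
  destruct (red_joinable M D E Hwf HMD HME) as (C & C' & HC & HC' & Heq).
  exists C, C'. repeat split; eauto using par_is_dist.
Qed.
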